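(* Let $\mathcal{W}=\{(W_i,\omega_i)\}_{i\in I}$ be a fusion frame for $\mathcal{H}$ and let $U\in B(\mathcal{H})$ be an invertible operator. Let $\gamma=\{\gamma_i\}_{i\in I}$ be a family of weights with $\gamma^{-1}=\{\gamma_i^{-1}\}_{i\in I}\in\ell^\infty$. Then the following are equivalent: (i) $\mathcal{W}$ is $(U,\gamma)$-scalable. (ii) The invertible operator $D_{U_\gamma}$ on $\sum_{i\in I}\bigoplus W_i$ satisfies $$T_{\mathcal{W}}D_{U_\gamma}^{-1}\left(D_{U_\gamma}^*\right)^{-1}T_{\mathcal{W}}^*=(U^*U)^{-1}.$$
   Context: $\mathcal{H}$ is a separable Hilbert space, $B(\mathcal{H})$ is the set of bounded operators on $\mathcal{H}$, $I$ is a countable index set, and $\pi_W$ is the orthogonal projection onto a closed subspace $W$. A family of weights is a family of strictly positive numbers. For closed subspaces $W_i$ of $\mathcal{H}$ and weights $\omega_i$, $\mathcal{W}=\{(W_i,\omega_i)\}_{i\in I}$ is a fusion frame for $\mathcal{H}$ if there are constants $0<A\le B<\infty$ with $A\|f\|^2\le\sum_{i\in I}\omega_i^2\|\pi_{W_i}f\|^2\le B\|f\|^2$ for all $f\in\mathcal{H}$; it is Parseval if $A=B=1$. The space $\sum_{i\in I}\bigoplus W_i=\{\{f_i\}_{i\in I}: f_i\in W_i,\ \sum_{i\in I}\|f_i\|^2<\infty\}$ is the $\ell^2$-direct sum, and $\sum_{i\in I}\bigoplus UW_i$ is defined similarly. The synthesis operator is $T_{\mathcal{W}}:\sum_{i\in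 I}\bigoplus W_i\to\mathcal{H}$, $T_{\mathcal{W}}(\{f_i\}_{i\in I})=\sum_{i\in I}\omega_if_i$. For an operator $U$ and a family of weights $\gamma=\{\gamma_i\}_{i\in I}$, the operator $D_{U_\gamma}:\sum_{i\in I}\bigoplus W_i\to\sum_{i\in I}\bigoplus UW_i$ is defined by $D_{U_\gamma}(\{f_i\}_{i\in I})=\{\gamma_i^{-1}Uf_i\}_{i\in I}$, where $f_i\in W_i$ for $i\in I$. For an invertible $U\in B(\mathcal{H})$ and a family of weights $\gamma$, $\mathcal{W}$ is called $(U,\gamma)$-scalable if $\{(UW_i,\omega_i\gamma_i)\}_{i\in I}$ is a Parseval fusion frame for $\mathcal{H}$.
   Formalization: Invertibility of D_{U_γ} (a bounded bijection from ⊕W_i onto ⊕UW_i with bounded inverse) is assumed for both implications, since γ^{-1} in ℓ^∞ does not give it and (i) does not imply it. *)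

(* Defs.v *)
From HB Require Import structures.
From mathcomp Require Import all_boot all_order all_algebra.
From mathcomp Require Import sesquilinear complex.
From mathcomp Require Import all_classical all_reals all_analysis.
From mathcomp.analysis.showcase Require Import summability.

Set Implicit Arguments.
Unset Strict Implicit.
Unset Printing Implicit Defensive.

Import Order.TTheory GRing.Theory Num.Theory.
Import numFieldNormedType.Exports.

Local Open Scope classical_set_scope.
Local Open Scope ring_scope.
Local Open Scope complex_scope.

(** Families are summed unconditionally: [partial_sum u @ totally] is the net of
    the sums of [u] over the finite subsets of the index type, and [sum u] is
    its limit (a junk value if there is none). *)
Definition has_sum (I : choiceType) (K : numFieldType) (V : normedModType K)
  (u : I -> V) : Prop := cvg (partial_sum u @ totally).

Definition real_or_complex (K : numFieldType) : Prop :=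
  exists R : realType, K = R :> numFieldType \/ K = R[i] :> numFieldType.

(** A Hilbert space over the reals or the complex numbers. Completeness is part
    of the type of [H]. The second condition forces [theta] to be the identity
    on the reals and complex conjugation on the complex numbers. Norms take
    their values in the nonnegative elements of [K]. *)
Definition hilbert (K : numFieldType) (H : completeNormedModType K)
    (theta : {rmorphism K -> K}) (dot : {dot H for theta}) : Prop :=
  [/\ real_or_complex K,
      forall z : K, z * theta z = `|z| ^+ 2
    & forall x : H, dot x x = `|x| ^+ 2].

Definition separable_space (T : topologicalType) : Prop :=
  exists2 S : set T, countable S & dense S.

(** An inner product space, presented as a linear subspace [dom] of an ambient
    module; [form] matters only on [dom]. An operator from [X] to [Y] is a
    function between the ambient modules, which matters only on [dom X]. *)
Record ipspace (K : numFieldType) := IPSpace {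
  carrier : lmodType K;
  dom : set carrier;
  form : carrier -> carrier -> K }.

Section Operators.
Context {K : numFieldType} (X Y : ipspace K).
Implicit Type A : carrier X -> carrier Y.

(** [form x x] is the squared norm, so [M] is a squared operator bound. *)
Definition bounded_op A : Prop :=
  set_fun (@dom K X) (@dom K Y) A /\
  exists M : K, forall x, dom x -> form (A x) (A x) <= M * form x x.

(** Both [op_inv] and [adjoint] are the expected operators when these exist, and
    take junk values otherwise. *)
Definition op_inv A : carrier Y -> carrier X := 'pinv_(fun=> 0) (@dom K X) A.

Definition adjoint A (y : carrier Y) : carrier X :=
  xget 0 [set x | dom x /\ forall x', dom x' -> form (A x') y = form x' x].

End Operators.

Arguments bounded_op {K} X Y A.
Arguments op_inv {K} X Y A _.
Arguments adjoint {K} X Y A _.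

Definition invertible_op (K : numFieldType) (X Y : ipspace K)
    (A : carrier X -> carrier Y) : Prop :=
  [/\ bounded_op X Y A, set_bij (@dom K X) (@dom K Y) A
    & bounded_op Y X (op_inv X Y A)].
Arguments invertible_op {K} X Y A.

Section FusionFrames.
Context {K : numFieldType} {H : completeNormedModType K}.
Context {theta : {rmorphism K -> K}} (dot : {dot H for theta}).
Context {I : countType}.

Definition closed_subspace (W : set H) : Prop :=
  [/\ closed W, W 0 & forall (a : K) x y, W x -> W y -> W (a *: x + y)].

Definition orthoproj (W : set H) (x : H) : H :=
  xget 0 [set y | W y /\ forall z, W z -> dot (x - y) z = 0].

Definition weights (w : I -> K) : Prop := forall i, 0 < w i.

Definition fusion_frame_bounds (W : I -> set H) (w : I -> K) (A B : K) : Prop :=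
  [/\ forall i, closed_subspace (W i), weights w
    & forall f : H,
        let u : I -> K^o := fun i => w i ^+ 2 * `|orthoproj (W i) f| ^+ 2 in
        has_sum u /\ A * `|f| ^+ 2 <= sum u <= B * `|f| ^+ 2].

Definition fusion_frame (W : I -> set H) (w : I -> K) : Prop :=
  exists A B : K, [/\ 0 < A, A <= B & fusion_frame_bounds W w A B].

Definition parseval_fusion_frame (W : I -> set H) (w : I -> K) : Prop :=
  fusion_frame_bounds W w 1 1.

Definition scalable_fusion_frame (U : H -> H) (gamma : I -> K)
    (W : I -> set H) (w : I -> K) : Prop :=
  parseval_fusion_frame (fun i => U @` W i) (fun i => w i * gamma i).

Definition whole : ipspace K := IPSpace setT dot.

(** The l^2-direct sum of the [W i], inside the module of all families. *)
Definition dsum (W : I -> set H) : ipspace K :=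
  @IPSpace K (I -> H)
    [set f | (forall i, W i (f i)) /\
             has_sum (fun i => `|f i| ^+ 2 : K^o)]
    (fun f g => sum (fun i => dot (f i) (g i) : K^o)).

Definition synthesis (w : I -> K) (f : I -> H) : H :=
  sum (fun i => w i *: f i).

Definition scaling_op (U : H -> H) (gamma : I -> K) (f : I -> H) : I -> H :=
  fun i => (gamma i)^-1 *: U (f i).

End FusionFrames.

(* Main.v *)
Require Import Defs.
From HB Require Import structures.
From mathcomp Require Import all_boot all_order all_algebra.
From mathcomp Require Import sesquilinear finmap complex.
From mathcomp Require Import all_classical all_reals all_analysis.
From mathcomp Require Import ring.
From mathcomp.analysis.showcase Require Import summability.
Import Order.TTheory GRing.Theory Num.Theory.
Import numFieldNormedType.Exports.
Local Open Scope classical_set_scope.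
Local Open Scope ring_scope.

Set Implicit Arguments.
Unset Strict Implicit.
Unset Printing Implicit Defensive.

(** Let [c i = w i * gamma i], let [T'] be the synthesis operator of the scaled
    family of the [(U W_i, c i)], and [S'] its frame operator, which maps [z] to
    the sum of the [c i ^+ 2 *: pi_{U W_i} z]. The inverse of [D] multiplies the
    entry of index [i] by [gamma i] and applies the inverse of [U] to it, so [T]
    after the inverse of [D] is [U^-1 T'], and the left-hand side of (ii) is this
    operator times its adjoint, that is [U^-1 S' (U^-1)^*]. The right-hand side is
    [U^-1 (U^-1)^*]. So (ii) says that [S'] is the identity, which is the Parseval
    property of the scaled family ([parseval_iff]).

    The two sides of (ii) are compared at a point [y], after application of [U].
    Let [z] be the vector such that [dot (U x) z = dot x y] for all [x]. The
    right-hand side becomes [z], and the left-hand side becomes [S' z]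
    ([scaled_frame_operatorE]). As [y] varies, [z] takes every value.

    The analytic point is that the family of the [c i *: pi_{U W_i} z] is square
    summable before anything is known about the Parseval property. This is
    [scaled_bessel]: the inverse of [D]
    is bounded, hence [gamma i] times the norm of [x] is at most a constant times
    the norm of [U x], for [x] in [W_i] and uniformly in [i]; the rest follows
    from the upper frame bound of [W] and the boundedness of [U].

    The projection theorem and the Riesz representation theorem, which provide the
    projections and the adjoints, are proved over the field [K] directly. The
    completeness of its order enters only through [real_or_complex_sup]. *)

#[local] Existing Instance totally_filter.

(** * Unconditional sums of nonnegative scalars *)

Section NonnegativeSums.
Context {K : numFieldType} {I : choiceType}.
Implicit Types (u v : I -> K) (A B : {fset I}).

Lemma partial_sumE (V : zmodType) (u : I -> V) A :
  partial_sum u A = \sum_(i <- A) u i.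
Proof. by rewrite /partial_sum [RHS]big_seq_fsetE. Qed.

Lemma near_totally A : \forall B \near @totally I, (A `<=` B)%fset.
Proof. by exists A. Qed.

Lemma sum_fsetD (V : zmodType) (u : I -> V) A B : (A `<=` B)%fset ->
  \sum_(i <- B) u i = \sum_(i <- A) u i + \sum_(i <- (B `\` A)%fset) u i.
Proof.
move=> AB; rewrite (big_fsetID _ (mem A)) /=; congr (_ + _).
  apply: eq_fbigl => i; rewrite !inE andbC.
  by case: (boolP (i \in A)) => //= /(fsubsetP AB) ->.
by apply: eq_fbigl => i; rewrite !inE andbC.
Qed.

Lemma le_sum_fset u A B : (forall i, 0 <= u i) -> (A `<=` B)%fset ->
  \sum_(i <- A) u i <= \sum_(i <- B) u i.
Proof. by move=> u0 /sum_fsetD ->; rewrite lerDl sumr_ge0. Qed.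

(** The scalars are only partially ordered, so that closedness of the order is
    reduced to continuity of the norm: the nonnegative scalars are the solutions
    of [`|x| = x]. *)
Lemma closed_nneg : closed [set x : K^o | 0 <= x].
Proof.
rewrite (_ : [set x | _] = (fun x : K^o => `|x| - x) @^-1` [set 0]); last first.
  apply/seteqP; split => x /=; first by move=> x0; rewrite ger0_norm ?subrr.
  by move=> /eqP; rewrite subr_eq0 => /eqP <-.
apply: preimage_closed.
  move=> x _; apply: (@continuousB K K^o K^o); last exact: cvg_id.
  exact: (@norm_continuous K K^o).
exact: (accessible_closed_set1 (hausdorff_accessible (@norm_hausdorff K K^o))).
Qed.

Lemma partial_sum_le_sum (u : I -> K^o) A : (forall i, 0 <= u i) -> has_sum u ->
  \sum_(i <- A) u i <= sum u.
Proof.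
move=> u0 cu; rewrite -subr_ge0.
apply: (@closed_cvg _ _ (@totally I) totally_filter
  (fun B => partial_sum u B - \sum_(i <- A) u i) _ closed_nneg).
  near=> B; rewrite /= partial_sumE subr_ge0 le_sum_fset//; near: B.
  exact: near_totally.
apply: (@cvgB _ K^o); [exact: cu | exact: cvg_cst].
Unshelve. all: by end_near. Qed.

End NonnegativeSums.

(** The one place where the scalars are inspected. A nonnegative complex number
    is real, so the least upper bound in the complex case is that of the set of
    real parts. *)
Lemma real_or_complex_sup (K : numFieldType) (S : set K) (M : K) :
  real_or_complex K -> S !=set0 -> (forall x, S x -> 0 <= x <= M) ->
  exists s, (forall x, S x -> x <= s) /\
            forall e, 0 < e -> exists2 x, S x & s - e < x.
Proof.
case=> R [] hK; subst K => S0 hS.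
  have hsup : has_sup S by split=> //; exists M => x /hS /andP[].
  exists (sup S); split; first by move=> x; exact: sup_upper_bound.
  by move=> e e0; exact: sup_adherent.
pose S' := [set complex.Re x | x in S].
have ReS x : S x -> x = real_complex R (complex.Re x).
  by move=> /hS /andP[+ _]; case: x => a b; rewrite lecE /= => /andP[/eqP -> _].
have hsup : has_sup S'.
  split; first by case: S0 => x Sx; exists (complex.Re x), x.
  exists (complex.Re M) => _ [x /hS /andP[_ +] <-].
  by rewrite lecE => /andP[_].
exists (real_complex R (sup S')); split=> [x Sx|e e0].
  rewrite [x]ReS // lecR; apply: sup_upper_bound => //; by exists x.
have [ee Ree] : e = real_complex R (complex.Re e) /\ 0 < complex.Re e.
  by move: e0; rewrite ltcE /=; case: e => a b /= /andP[/eqP ->].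
have [_ [x Sx <-] lt] := sup_adherent Ree hsup.
by exists x => //; rewrite [x]ReS // ee -rmorphB /= ltcR.
Qed.

(** Reflecting the elements of [S] below some [M] in [S] turns their infimum into
    a supremum of nonnegative elements bounded by [M]; the elements of [S] above
    [M] do not affect the infimum, nonnegative scalars being comparable. *)
Lemma real_or_complex_inf (K : numFieldType) (S : set K) :
  real_or_complex K -> S !=set0 -> (forall x, S x -> 0 <= x) ->
  exists d, (forall x, S x -> d <= x) /\
            forall e, 0 < e -> exists2 x, S x & x < d + e.
Proof.
move=> RC [M SM] S0.
have [s [s_ub s_lub]] := @real_or_complex_sup K
  [set M - x | x in [set x | S x /\ x <= M]] M RC
  (ex_intro _ _ (ex_intro2 _ _ M (conj SM (lexx M)) erefl))
  ltac:(by move=> _ [x [Sx xM] <-]; rewrite subr_ge0 xM gerBl S0).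
exists (M - s); split=> [x Sx|e e0]; last first.
  have [_ [x [Sx _] <-] lt] := s_lub e e0; exists x => //.
  rewrite -subr_gt0 (_ : M - s + e - x = M - x - (s - e)); last by ring.
  by rewrite subr_gt0.
have [xM|/ltW Mx] := real_leP (ger0_real (S0 _ Sx)) (ger0_real (S0 _ SM)).
  by rewrite lerBlDr addrC -lerBlDr; apply: s_ub; exists x.
apply: le_trans Mx; rewrite gerBl; apply: s_ub.
by exists M; rewrite ?subrr.
Qed.

Section BoundedSums.
Context {K : numFieldType} {I : choiceType}.
Hypothesis RC : real_or_complex K.

Lemma bounded_has_sum (u : I -> K^o) (M : K) : (forall i, 0 <= u i) ->
  (forall A : {fset I}, \sum_(i <- A) u i <= M) -> has_sum u /\ sum u <= M.
Proof.
move=> u0 uM.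
have [s [s_ub s_lub]] := @real_or_complex_sup K
  (range (fun A : {fset I} => \sum_(i <- A) u i)) M RC
  (ex_intro _ _ (ex_intro2 _ _ fset0 Logic.I erefl))
  ltac:(by move=> _ [A _ <-]; rewrite uM sumr_ge0).
have cvs : partial_sum u @ totally --> (s : K^o).
  apply/cvgrPdist_lt => e e0.
  have [_ [A _ <-] lt] := s_lub e e0.
  near=> B; rewrite partial_sumE ger0_norm ?subr_ge0; last by apply: s_ub; exists B.
  rewrite ltrBlDl -ltrBlDr; apply: lt_le_trans lt _.
  by apply: le_sum_fset => //; near: B; exact: near_totally.
split; first by apply/cvg_ex; exists s.
have -> : sum u = s by apply: cvg_lim => //; exact: (@norm_hausdorff K K^o).
apply/ler_addgt0Pr => e e0; have [_ [A _ <-] /ltW] := s_lub e e0.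
by rewrite lerBlDr => /le_trans -> //; rewrite lerD2r.
Unshelve. all: by end_near. Qed.

Lemma le_has_sum (u v : I -> K^o) (C : K) : 0 <= C ->
  (forall i, 0 <= u i <= C * v i) -> (forall i, 0 <= v i) -> has_sum v ->
  has_sum u.
Proof.
move=> C0 uv v0 cv.
apply: (proj1 (@bounded_has_sum u (C * sum v) _ _)).
  by move=> i; have /andP[] := uv i.
move=> A; apply: (@le_trans _ _ (C * \sum_(i <- A) v i)).
  by rewrite mulr_sumr ler_sum // => i _; have /andP[] := uv i.
by rewrite ler_wpM2l // partial_sum_le_sum.
Qed.

End BoundedSums.

(** * Unconditional sums of vectors *)

Section VectorSums.
Context {K : numFieldType} {I : choiceType}.

(** The hypothesis also bounds the sum of [u] over [B `\` A], when [A] is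
    contained in [B], by [C] times the corresponding increment of the partial
    sums of [v], which is a tail of a convergent sum. So the partial sums of [u]
    form a Cauchy filter. *)
Lemma has_sum_dominated (H : completeNormedModType K) (u : I -> H)
    (v : I -> K^o) (C : K) : 0 < C -> (forall i, 0 <= v i) -> has_sum v ->
  (forall A : {fset I}, `|\sum_(i <- A) u i| ^+ 2 <= C * \sum_(i <- A) v i) ->
  has_sum u.
Proof.
move=> C0 v0 cv uv; apply: cauchy_cvg; apply: cauchy_exP => e e0.
have d0 : 0 < C^-1 * e ^+ 2 by rewrite mulr_gt0 ?invr_gt0 ?exprn_gt0.
have [A _ hA] : \forall A \near @totally I,
    `|(sum v : K^o) - partial_sum v A| < C^-1 * e ^+ 2.
  exact: (proj1 (@cvgrPdist_lt K K^o _ _ totally_filter _ _) cv).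
exists (\sum_(i <- A) u i); exists A => // B AB.
rewrite -ball_normE /ball_ /= partial_sumE (sum_fsetD _ AB) opprD addNKr normrN.
rewrite -(ltr_pXn2r (n := 2)) ?nnegrE //; last exact: ltW.
apply: le_lt_trans (uv _) _; rewrite -ltr_pdivlMl //.
have -> : \sum_(i <- (B `\` A)%fset) v i = \sum_(i <- B) v i - \sum_(i <- A) v i.
  by rewrite (sum_fsetD v AB) addrC addKr.
apply: le_lt_trans (hA A (fsubset_refl A)).
rewrite partial_sumE ger0_norm ?subr_ge0; last exact: partial_sum_le_sum.
by rewrite lerD2r partial_sum_le_sum.
Qed.

Lemma has_sum_map (V W : normedModType K) (f : V -> W) (u : I -> V) :
  f 0 = 0 -> {morph f : x y / x + y} -> continuous f -> has_sum u ->
  has_sum (f \o u) /\ sum (f \o u) = f (sum u).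
Proof.
move=> f0 fD fc cu.
have cf : partial_sum (f \o u) @ totally --> f (sum u).
  have -> : partial_sum (f \o u) = f \o partial_sum u.
    by apply/funext => A; rewrite /= !partial_sumE (big_morph f fD f0).
  by apply: continuous_cvg => //; exact: fc.
split; first by apply/cvg_ex; exists (f (sum u)).
by apply: cvg_lim => //; exact: norm_hausdorff.
Qed.

Lemma sum_single (V : normedModType K) (u : I -> V) (i : I) :
  (forall j, j != i -> u j = 0) -> has_sum u /\ sum u = u i.
Proof.
move=> u0; have cu : partial_sum u @ totally --> u i.
  apply: cvg_near_cst; exists [fset i]%fset => // A /=; rewrite fsub1set => iA.
  rewrite partial_sumE (big_fsetD1 i) //= big_seq big1 ?addr0 // => j.
  by rewrite !inE => /andP[/u0].
split; first by apply/cvg_ex; exists (u i).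
by apply: cvg_lim => //; exact: norm_hausdorff.
Qed.

End VectorSums.

(** The bound is on squares, as for the operators of an inner product space. The
    field has no square roots, and [M + 1] serves as an upper bound for one. *)
Lemma bounded_additive_continuous (K : numFieldType) (V W : normedModType K)
    (f : V -> W) (M : K) : 0 < M -> {morph f : x y / x - y} ->
  (forall x, `|f x| ^+ 2 <= M * `|x| ^+ 2) -> continuous f.
Proof.
move=> M0 fB fM x; apply/cvgrPdist_lt => e e0.
have M1 : 0 < M + 1 by rewrite addr_gt0.
near=> y.
rewrite -fB; apply: (@le_lt_trans _ _ ((M + 1) * `|x - y|)).
  rewrite -(ler_pXn2r (n := 2)) ?nnegrE // ?mulr_ge0 // ?(ltW M1) //.
  apply: le_trans (fM _) _; rewrite exprMn ler_wpM2r ?exprn_ge0 //.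
  rewrite sqrrD expr1n mulr1 -subr_ge0 addrAC [M *+ 2]mulr2n addrA addrK.
  by rewrite !addr_ge0 ?exprn_ge0 // ltW.
rewrite -ltr_pdivlMl //; near: y.
apply: (proj1 (cvgrPdist_lt (fun z : V => z) x)); first exact: cvg_id.
by rewrite mulr_gt0 ?invr_gt0.
Unshelve. all: by end_near. Qed.

(** * Operators between inner product spaces *)

Section Operators.
Context {K : numFieldType}.

(** On bijections between the domains the junk values of [op_inv] are never
    reached. *)
Lemma op_inv_mem (X Y : ipspace K) (A : carrier X -> carrier Y)
    (y : carrier Y) :
  set_bij (@dom K X) (@dom K Y) A -> dom y ->
  dom (op_inv X Y A y) /\ A (op_inv X Y A y) = y.
Proof.
move=> [_ A_inj A_surj] /A_surj[x Xx <-].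
by rewrite /op_inv pinvKV ?inE.
Qed.

Lemma op_invK (X Y : ipspace K) (A : carrier X -> carrier Y)
    (x : carrier X) :
  {in @dom K X &, injective A} -> dom x -> op_inv X Y A (A x) = x.
Proof. by move=> A_inj Xx; rewrite /op_inv pinvKV ?inE. Qed.

(** A bound [M] in a partially ordered field need not be comparable with 0, but
    it can always be replaced by a positive one. *)
Lemma le_mul_norm_add1 (a b M : K) : 0 <= a -> 0 <= b -> a <= M * b ->
  a <= (`|M| + 1) * b.
Proof.
move=> a0 b0 aM; have := le_trans a0 aM => Mb0.
apply: (le_trans aM); rewrite -(ger0_norm Mb0) normrM (ger0_norm b0).
by rewrite ler_wpM2r // lerDl.
Qed.

End Operators.

(** * Geometry of a Hilbert space *)

Section HilbertSpace.
Context {K : numFieldType} {H : completeNormedModType K}.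
Context {theta : {rmorphism K -> K}} {dot : {dot H for theta}}.
Hypothesis hilbH : hilbert dot.
Implicit Types (x y z : H) (W : set H).

Lemma hilbert_RC : real_or_complex K. Proof. by case: hilbH. Qed.

Lemma mul_theta (a : K) : a * theta a = `|a| ^+ 2.
Proof. by case: hilbH => _ + _; exact. Qed.

Lemma dotxx x : dot x x = `|x| ^+ 2.
Proof. by case: hilbH => _ _; exact. Qed.

Lemma dot_sym x y : dot x y = theta (dot y x).
Proof. by rewrite (hermC dot) mul1r. Qed.

Lemma dotZl (a : K) x y : dot (a *: x) y = a * dot x y.
Proof. by rewrite linearZl_LR. Qed.

Lemma dotZr (a : K) x y : dot x (a *: y) = theta a * dot x y.
Proof. by rewrite linearZr_LR. Qed.

(** The law [a * theta a = `|a| ^+ 2] replaces any case analysis between the real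
    and the complex scalars: it makes [theta] fix the nonnegative scalars and be
    an involution. *)
Lemma theta_nneg (a : K) : 0 <= a -> theta a = a.
Proof.
move=> a0; have [->|an0] := eqVneq a 0; first by rewrite rmorph0.
by apply: (mulfI an0); rewrite mul_theta ger0_norm.
Qed.

Lemma thetaK (a : K) : theta (theta a) = a.
Proof.
have [->|an0] := eqVneq a 0; first by rewrite !rmorph0.
have tn0 : theta a != 0 by rewrite fmorph_eq0.
apply: (mulfI tn0); rewrite [RHS]mulrC [RHS]mul_theta.
by rewrite -(theta_nneg (exprn_ge0 _ (normr_ge0 a))) -mul_theta rmorphM.
Qed.

Lemma normsqB x y :
  `|x - y| ^+ 2 = `|x| ^+ 2 - dot x y - theta (dot x y) + `|y| ^+ 2.
Proof.
by rewrite -!dotxx linearBl /= !linearBr /= [dot y x]dot_sym; ring.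
Qed.

Lemma parallelogram x y :
  `|x - y| ^+ 2 + `|x + y| ^+ 2 = `|x| ^+ 2 *+ 2 + `|y| ^+ 2 *+ 2.
Proof.
rewrite -{2}[y]opprK !normsqB linearNr /= rmorphN /= normrN; ring.
Qed.

(** Pythagoras, for the component of [x] orthogonal to [y]. *)
Lemma normsq_sub_component x y : y != 0 ->
  `|x - (dot x y / `|y| ^+ 2) *: y| ^+ 2
  = `|x| ^+ 2 - `|dot x y| ^+ 2 / `|y| ^+ 2.
Proof.
move=> y0; have n0 : `|y| ^+ 2 != 0 by rewrite expf_neq0 // normr_eq0.
have tE : theta (dot x y / `|y| ^+ 2) = theta (dot x y) / `|y| ^+ 2.
  rewrite rmorphM; congr (_ * _).
  by apply: theta_nneg; rewrite invr_ge0 exprn_ge0.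
rewrite normsqB dotZr tE.
have -> : theta (dot x y) / `|y| ^+ 2 * dot x y = `|dot x y| ^+ 2 / `|y| ^+ 2.
  by rewrite -mul_theta; ring.
rewrite theta_nneg ?divr_ge0 ?exprn_ge0 // normrZ exprMn normrM normfV normrX normr_id.
by field; rewrite normr_eq0.
Qed.

Lemma cauchy_schwarz x y : `|dot x y| ^+ 2 <= `|x| ^+ 2 * `|y| ^+ 2.
Proof.
have [->|y0] := eqVneq y 0; first by rewrite linear0r !normr0 expr0n mulr0.
have n0 : 0 < `|y| ^+ 2 by rewrite exprn_gt0 // normr_gt0.
by rewrite -ler_pdivrMr // -subr_ge0 -normsq_sub_component // exprn_ge0.
Qed.

Lemma continuous_dotl y : continuous (fun x => dot x y : K^o).
Proof.
apply: (@bounded_additive_continuous K H K^o _ (`|y| ^+ 2 + 1)).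
- by rewrite ltr_wpDl ?exprn_ge0.
- by move=> a b; rewrite linearBl.
move=> x; apply: le_trans (cauchy_schwarz x y) _.
by rewrite mulrC ler_wpM2r ?exprn_ge0 // lerDl.
Qed.

(** Squared norms of limits are bounded through this lemma, the order of the
    scalars being only partial. *)
Lemma closed_cball x (C : K) : closed [set z | `|x - z| ^+ 2 <= C].
Proof.
rewrite (_ : [set z | _] = (fun z => C - `|x - z| ^+ 2 : K^o) @^-1` [set a | 0 <= a]).
  apply: preimage_closed closed_nneg => z _.
  apply: (@continuousB K K^o H); first exact: cst_continuous.
  have nc : {for z, continuous (fun z : H => `|x - z| : K)}.
    apply: continuous_comp; last exact: norm_continuous.
    apply: continuousB; first exact: cst_continuous.
    exact: cvg_id.
  exact: (continuousM nc nc).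
by apply/seteqP; split=> z /=; rewrite subr_ge0.
Qed.

(** By the parallelogram law, approximate minimizers in [W] of the distance to
    [x] are close to each other, so they form a Cauchy filter. Its limit [y]
    attains the minimum, and removing from [x - y] its component along some [z] in
    [W] cannot decrease the norm; that component is therefore 0. *)
Lemma projection_exists W x : closed_subspace W ->
  exists y, W y /\ forall z, W z -> dot (x - y) z = 0.
Proof.
move=> [clW W0 Wlin].
have WZ a z : W z -> W (a *: z) by move=> Wz; rewrite -[_ *: _]addr0; exact: Wlin.
have WD z z' : W z -> W z' -> W (z + z').
  by move=> Wz Wz'; rewrite -[z]scale1r; exact: Wlin.
have [d [d_lb d_glb]] := @real_or_complex_inf K
  [set `|x - z| ^+ 2 | z in W] hilbert_RC (ex_intro _ _ (ex_intro2 _ _ 0 W0 erefl))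
  ltac:(by move=> _ [z _ <-]; rewrite exprn_ge0).
have dW z : W z -> d <= `|x - z| ^+ 2 by move=> Wz; apply: d_lb; exists z.
pose near_min e := [set z | W z /\ `|x - z| ^+ 2 < d + e].
pose F := filter_from [set e : K | 0 < e] near_min.
have FF : ProperFilter F.
  apply: filter_from_proper; last first.
    by move=> e /= /d_glb [_ [z Wz <-] lt]; exists z.
  apply: filter_from_filter; first by exists 1 => /=.
  move=> e e' /= e0 e'0.
  have [le|/ltW le] := real_leP (gtr0_real e0) (gtr0_real e'0).
    exists e => // z [Wz lt]; split; split => //.
    by apply: lt_le_trans lt _; rewrite lerD2l.
  exists e' => // z [Wz lt]; split; split => //.
  by apply: lt_le_trans lt _; rewrite lerD2l.
have near_min_close e z z' : near_min e z -> near_min e z' ->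
    `|z - z'| ^+ 2 < e *+ 4.
  move=> [Wz lt] [Wz' lt'].
  (* The midpoint of z and z' lies in W, so its distance to x is at least the
     infimum. *)
  have mid : d *+ 4 <= `|(x - z') + (x - z)| ^+ 2.
    have -> : (x - z') + (x - z) = 2 *: (x - 2^-1 *: (z + z')).
      rewrite scalerBr scalerA divff ?pnatr_eq0 // scale1r scaler_nat mulr2n.
      by rewrite opprD addrACA [- z - z']addrC.
    rewrite normrZ exprMn ger0_norm // -natrX mulr_natl lerMn2r /=.
    by apply: dW; apply/WZ/WD.
  have -> : z - z' = (x - z') - (x - z).
    by rewrite opprB [x - z' + _]addrC addrA subrK.
  rewrite -(ltrD2r (`|(x - z') + (x - z)| ^+ 2)) parallelogram.
  apply: (@lt_le_trans _ _ ((d + e) *+ 2 + (d + e) *+ 2)).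
    by rewrite ltrD // ltrMn2r.
  by rewrite -mulrnDr mulrnDl [leRHS]addrC lerD2r.
have cF : cvg F.
  apply: cauchy_cvg; apply: cauchy_exP => e e0.
  have e40 : 0 < 4^-1 * e ^+ 2 by rewrite mulr_gt0 ?exprn_gt0.
  have [_ [z0 Wz0 <-] lt0] := d_glb _ e40.
  exists z0, (4^-1 * e ^+ 2) => // z hz.
  rewrite -ball_normE /ball_ /= -(ltr_pXn2r (n := 2)) ?nnegrE //; last exact: ltW.
  apply: lt_le_trans (near_min_close _ _ _ (conj Wz0 lt0) hz) _.
  by rewrite (_ : _ *+ 4 = e ^+ 2) //; field.
pose y := lim F; exists y.
have Wy : W y.
  apply: (@closed_cvg _ _ F _ id W clW) => //.
  by exists 1 => //= z [].
split=> // z Wz.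
have xyd : `|x - y| ^+ 2 <= d.
  apply/ler_addgt0Pr => e e0.
  apply: (@closed_cvg _ _ F _ id _ (closed_cball (x := x) (C := d + e))) => //.
  by exists e => //= z' [_ /ltW].
have [->|z0] := eqVneq z 0; first by rewrite linear0r.
have := dW _ (WD _ _ Wy (WZ (dot (x - y) z / `|z| ^+ 2) _ Wz)).
rewrite opprD addrA normsq_sub_component // => /(le_trans xyd).
rewrite -subr_ge0 addrAC.
rewrite subrr sub0r oppr_ge0 pmulr_lle0 ?invr_gt0 ?exprn_gt0 ?normr_gt0 // => le0.
by apply/eqP; rewrite -normr_eq0 -sqrf_eq0; apply/eqP/le_anti; rewrite le0 exprn_ge0.
Qed.

Lemma orthoproj_mem W x : closed_subspace W -> W (orthoproj dot W x).
Proof. by move=> cW; have [] := xgetPex 0 (projection_exists x cW). Qed.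

Lemma dot_orthoproj W x z : closed_subspace W -> W z ->
  dot z (orthoproj dot W x) = dot z x.
Proof.
move=> cW Wz; have [_ /(_ z Wz)] := xgetPex 0 (projection_exists x cW).
move/(congr1 theta); rewrite -dot_sym rmorph0 linearBr /= => /eqP.
by rewrite subr_eq0 => /eqP.
Qed.

Lemma dot_orthoproj_self W x : closed_subspace W ->
  dot x (orthoproj dot W x) = `|orthoproj dot W x| ^+ 2.
Proof.
move=> cW; have Wp := orthoproj_mem x cW.
by rewrite dot_sym -(dot_orthoproj x cW Wp) dotxx theta_nneg ?exprn_ge0.
Qed.

Lemma dot_inj x y : (forall z, dot z x = dot z y) -> x = y.
Proof.
move=> h; apply/eqP; rewrite -subr_eq0 -normr_eq0 -sqrf_eq0 -dotxx linearBr /=.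
by rewrite h subrr.
Qed.

(** A nonzero [phi] vanishes exactly on the orthogonal complement of the line
    spanned by [p], the residue of some vector outside the kernel after projection
    onto the kernel. The kernel element [phi p *: x - phi x *: p] is orthogonal to
    [p], which gives [phi x] as a multiple of [dot x p]. *)
Lemma riesz (phi : H -> K^o) (M : K) : 0 < M ->
    (forall a x y, phi (a *: x + y) = a * phi x + phi y) ->
    (forall x, `|phi x| ^+ 2 <= M * `|x| ^+ 2) ->
  exists z, forall x, phi x = dot x z.
Proof.
move=> M0 philin phiM.
have phi0 : phi 0 = 0.
  have := philin 1 0 0; rewrite scale1r addr0 mul1r => /eqP.
  by rewrite -subr_eq0 opprD addNKr oppr_eq0 => /eqP.
have phiB : {morph phi : x y / x - y}.
  by move=> x y; rewrite addrC -scaleN1r philin mulN1r addrC.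
pose N := [set x | phi x = 0].
have cN : closed_subspace N.
  split=> //; last first.
    by move=> a x y; rewrite /N /= => px py; rewrite philin px py mulr0 addr0.
  apply: (@preimage_closed _ _ phi [set 0]).
    by move=> x _; exact: (bounded_additive_continuous M0 phiB phiM).
  exact: (accessible_closed_set1 (hausdorff_accessible (@norm_hausdorff K K^o))).
have [phi_eq0|] := pselect (forall x, phi x = 0).
  by exists 0 => x; rewrite linear0r phi_eq0.
move=> /existsNP[x0 px0].
pose p := x0 - orthoproj dot N x0.
have pp : phi p = phi x0.
  by rewrite phiB (_ : phi (orthoproj _ _ _) = 0) ?subr0 //; exact: (orthoproj_mem x0 cN).
have pn0 : p != 0 by apply/eqP => p0; apply: px0; rewrite -pp p0.
have n0 : `|p| ^+ 2 != 0 by rewrite expf_neq0 // normr_eq0.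
have Np z : N z -> dot z p = 0.
  by move=> Nz; rewrite linearBr /= (dot_orthoproj x0 cN Nz) subrr.
exists (theta (phi p / `|p| ^+ 2) *: p) => x.
have : dot (phi p *: x - phi x *: p) p = 0.
  by apply: Np; rewrite /N /= -scaleNr addrC !philin -[phi p *: x]addr0 philin phi0; ring.
rewrite linearBl /= !dotZl dotxx => /eqP; rewrite subr_eq0 => /eqP h.
by rewrite dotZr thetaK mulrAC h mulfK.
Qed.

Lemma norm_orthoproj_le W x : closed_subspace W ->
  `|orthoproj dot W x| ^+ 2 <= `|x| ^+ 2.
Proof.
move=> cW; have := exprn_ge0 2 (normr_ge0 (x - orthoproj dot W x)).
rewrite normsqB dot_orthoproj_self // theta_nneg ?exprn_ge0 //.
by rewrite addrAC subrK subr_ge0.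
Qed.

Lemma closed_subspaceZ W (a : K) x : closed_subspace W -> W x -> W (a *: x).
Proof. by move=> [_ W0 lin] Wx; rewrite -[_ *: _]addr0; exact: lin. Qed.

(** The image under [A] is the preimage under the continuous [B]. *)
Lemma closed_subspace_image (A : {linear H -> H}) (B : H -> H) W :
    cancel A B -> cancel B A -> continuous B -> closed_subspace W ->
  closed_subspace (A @` W).
Proof.
move=> AK BK cB [clW W0 lin]; split.
- rewrite (_ : A @` W = B @^-1` W).
    by apply: preimage_closed clW => x _; exact: cB.
  apply/seteqP; split=> [_ [x Wx <-]|x Wx] /=; first by rewrite AK.
  by exists (B x).
- by exists 0; rewrite ?linear0.
- move=> a _ _ [x Wx <-] [y Wy <-]; exists (a *: x + y); first exact: lin.
  by rewrite linearP.
Qed.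

(** * Operators on a Hilbert space *)

(** The adjoint has the bound of the operator: take [x = z], apply
    Cauchy-Schwarz, and divide by [`|z| ^+ 2]. *)
Lemma adjoint_bound (A : H -> H) (M : K) y z :
    (forall x, `|A x| ^+ 2 <= M * `|x| ^+ 2) ->
    (forall x, dot (A x) y = dot x z) ->
  `|z| ^+ 2 <= M * `|y| ^+ 2.
Proof.
move=> AM Az; have [z0|zn0] := eqVneq z 0.
  rewrite z0 normr0 expr0n /=.
  have := AM y; have [->|yn0 My] := eqVneq y 0; first by rewrite normr0 expr0n mulr0.
  by apply: le_trans My; rewrite exprn_ge0.
have n0 : 0 < `|z| ^+ 2 by rewrite exprn_gt0 // normr_gt0.
rewrite -(ler_pM2l n0).
have -> : `|z| ^+ 2 * `|z| ^+ 2 = `|dot (A z) y| ^+ 2.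
  by rewrite Az dotxx normrX normr_id -expr2.
apply: le_trans (cauchy_schwarz _ _) _.
by rewrite [leRHS]mulrCA [leRHS]mulrA ler_wpM2r // exprn_ge0.
Qed.

Lemma bounded_op_wholeP (A : H -> H) : bounded_op (whole dot) (whole dot) A ->
  exists2 M, 0 < M & forall x, `|A x| ^+ 2 <= M * `|x| ^+ 2.
Proof.
move=> [_ [M AM]]; exists (`|M| + 1); first by rewrite ltr_wpDl.
move=> x; apply: le_mul_norm_add1; rewrite ?exprn_ge0 //.
by have := AM x Logic.I; rewrite /= !dotxx.
Qed.

Lemma adjoint_exists (A : H -> H) (M : K) y : 0 < M ->
    (forall a, {morph A : x z / a *: x + z}) ->
    (forall x, `|A x| ^+ 2 <= M * `|x| ^+ 2) ->
  exists z, forall x, dot (A x) y = dot x z.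
Proof.
move=> M0 Alin AM.
apply: (@riesz (fun x => dot (A x) y : K^o) (M * (`|y| ^+ 2 + 1))).
- by rewrite mulr_gt0 // ltr_wpDl ?exprn_ge0.
- by move=> a x1 x2; rewrite Alin linearDl /= dotZl.
move=> x; apply: le_trans (cauchy_schwarz _ _) _.
apply: (@le_trans _ _ (M * `|x| ^+ 2 * `|y| ^+ 2)).
  by rewrite ler_wpM2r ?exprn_ge0.
by rewrite mulrAC ler_wpM2r ?exprn_ge0 // ler_wpM2l ?lerDl //; exact: ltW.
Qed.

Lemma adjoint_wholeP (A : {linear H -> H}) (M : K) x y : 0 < M ->
    (forall x, `|A x| ^+ 2 <= M * `|x| ^+ 2) ->
  dot (A x) y = dot x (adjoint (whole dot) (whole dot) A y).
Proof.
move=> M0 AM; have [z Az] := adjoint_exists y M0 (linearP A) AM.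
by have [_ /(_ x Logic.I)] := xgetPex (0 : H) (ex_intro
  (fun z => @dom K (whole dot) z /\ forall x, @dom K (whole dot) x ->
     dot (A x) y = dot x z) z (conj Logic.I (fun x _ => Az x))).
Qed.

(** * Synthesis operators and direct sums *)

Section Families.
Context {I : countType}.
Implicit Types (V : I -> set H) (c : I -> K) (f g : I -> H).

(** The adjoint of synthesis is the analysis map, whose bound is the upper frame
    bound; so synthesis has the same bound. With [v] the left-hand vector and
    [p i] its analysis coefficients, the inner product of [f] and [p] over [A] is
    [`|v| ^+ 2]. Expanding the nonnegative square of [B *: f - p] takes the place
    of Cauchy-Schwarz in the finite direct sum. *)
Lemma synthesis_fset_bound V c (B : K) f (A : {fset I}) : 0 < B ->
    (forall i, closed_subspace (V i)) -> (forall i, 0 <= c i) ->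
    (forall x, \sum_(i <- A) c i ^+ 2 * `|orthoproj dot (V i) x| ^+ 2
               <= B * `|x| ^+ 2) ->
    (forall i, V i (f i)) ->
  `|\sum_(i <- A) c i *: f i| ^+ 2 <= B * \sum_(i <- A) `|f i| ^+ 2.
Proof.
move=> B0 cV c0 bV Vf; set v := \sum_(i <- A) _.
pose p i := c i *: orthoproj dot (V i) v.
have sp : \sum_(i <- A) `|p i| ^+ 2 <= B * `|v| ^+ 2.
  apply: le_trans (bV v); rewrite le_eqVlt; apply/orP; left; apply/eqP.
  by apply: eq_bigr => i _; rewrite normrZ exprMn ger0_norm.
have sfp : \sum_(i <- A) dot (f i) (p i) = `|v| ^+ 2.
  rewrite -dotxx {1}/v linear_sumlz; apply: eq_bigr => i _.
  by rewrite dotZr theta_nneg // dot_orthoproj //; exact/esym/dotZl.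
have : 0 <= \sum_(i <- A) `|B *: f i - p i| ^+ 2.
  by apply: sumr_ge0 => i _; rewrite exprn_ge0.
have -> : \sum_(i <- A) `|B *: f i - p i| ^+ 2
  = B ^+ 2 * \sum_(i <- A) `|f i| ^+ 2 - B * `|v| ^+ 2 - B * `|v| ^+ 2
    + \sum_(i <- A) `|p i| ^+ 2.
  transitivity (\sum_(i <- A) (B ^+ 2 * `|f i| ^+ 2 - B * dot (f i) (p i)
      - theta (B * dot (f i) (p i)) + `|p i| ^+ 2)).
    apply: eq_bigr => i _.
    by rewrite normsqB dotZl normrZ exprMn (gtr0_norm B0).
  rewrite !big_split /= !sumrN -rmorph_sum -!mulr_sumr sfp [theta _]theta_nneg //.
  by rewrite mulr_ge0 ?exprn_ge0 // ltW.
move=> h.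
have : 0 <= B ^+ 2 * \sum_(i <- A) `|f i| ^+ 2 - B * `|v| ^+ 2.
  apply: le_trans h _; rewrite -subr_ge0.
  rewrite [_ - (_ + _)](_ : _ = B * `|v| ^+ 2 - \sum_(i <- A) `|p i| ^+ 2); last by ring.
  by rewrite subr_ge0.
by rewrite subr_ge0 expr2 -mulrA ler_pM2l.
Qed.

Lemma synthesis_bound V c (B : K) f : 0 < B ->
    (forall i, closed_subspace (V i)) -> (forall i, 0 <= c i) ->
    (forall x (A : {fset I}),
       \sum_(i <- A) c i ^+ 2 * `|orthoproj dot (V i) x| ^+ 2 <= B * `|x| ^+ 2) ->
    dom (i := dsum dot V) f ->
  has_sum (fun i => c i *: f i) /\
  `|synthesis c f| ^+ 2 <= B * sum (fun i => `|f i| ^+ 2 : K^o).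
Proof.
move=> B0 cV c0 bV [Vf sf].
have f0 i : 0 <= `|f i| ^+ 2 by rewrite exprn_ge0.
have bf A := synthesis_fset_bound B0 cV c0 (fun x => bV x A) Vf.
have cf : has_sum (fun i => c i *: f i).
  exact: (@has_sum_dominated K I H _ (fun i => `|f i| ^+ 2) _ B0 f0 sf bf).
split=> //; rewrite -normrN -sub0r.
apply: (@closed_cvg _ _ (@totally I) totally_filter _ _
  (closed_cball (x := 0) (C := B * sum (fun i => `|f i| ^+ 2 : K^o))) _ _ cf).
near=> A; rewrite /= sub0r normrN partial_sumE; apply: le_trans (bf A) _.
by rewrite ler_wpM2l ?(ltW B0) // partial_sum_le_sum.
Unshelve. all: by end_near. Qed.

(** The test vectors of a direct sum: pairing with them reads off one entry, and
    an operator bound specializes to a bound on one summand. *)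
Definition single (i : I) (x : H) : I -> H := fun j => if j == i then x else 0.

Lemma single_dsum V i x : (forall j, closed_subspace (V j)) -> V i x ->
  @dom K (dsum dot V) (single i x).
Proof.
move=> cV Vx; split=> [j|]; rewrite /single.
  by case: eqP => [->//|_]; have [] := cV j.
by apply: (proj1 (@sum_single K I K^o _ i _)) => j /negbTE ->; rewrite normr0 expr0n.
Qed.

Lemma form_single V i x g : @Defs.form K (dsum dot V) (single i x) g = dot x (g i).
Proof.
rewrite /= (proj2 (@sum_single K I K^o _ i _)) /single ?eqxx // => j /negbTE ->.
by rewrite linear0l.
Qed.

(** Test with the family whose only nonzero entry is [f i - g i]. *)
Lemma dsum_separated V f g : (forall i, closed_subspace (V i)) ->
    @dom K (dsum dot V) f -> @dom K (dsum dot V) g ->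
    (forall h, @dom K (dsum dot V) h ->
       @Defs.form K (dsum dot V) h f = @Defs.form K (dsum dot V) h g) ->
  f = g.
Proof.
move=> cV [Vf _] [Vg _] fg; apply/funext => i.
have Vd : V i (f i - g i).
  by have [_ _ lin] := cV i; rewrite addrC -scaleN1r; exact: lin.
have := fg _ (single_dsum cV Vd); rewrite !form_single => /eqP.
rewrite -subr_eq0 -linearBr /= dotxx sqrf_eq0 normr_eq0 subr_eq0.
by move/eqP.
Qed.

(** A vector with the defining property of the adjoint is the value of
    [adjoint], since inner products determine a vector of a direct sum. *)
Lemma adjoint_dsumP (Y : ipspace K) V (A : (I -> H) -> carrier Y)
    (y : carrier Y) f :
    (forall i, closed_subspace (V i)) -> @dom K (dsum dot V) f ->
    (forall h, @dom K (dsum dot V) h ->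
       Defs.form (A h) y = @Defs.form K (dsum dot V) h f) ->
  adjoint (dsum dot V) Y A y = f.
Proof.
move=> cV Vf Af; apply: xget_subset1; first by split.
move=> g g' [Vg Ag] [Vg' Ag']; apply: (dsum_separated cV Vg Vg') => h Vh.
by rewrite -Ag // -Ag'.
Qed.

(** * Parseval fusion frames *)

(** Let [S] be the frame operator. The frame sum at [x] is [dot (S x) x], so that
    [S x = x] gives the Parseval identity. Conversely, under this identity
    synthesis is a contraction and [S x] is the synthesis of a family of norm
    [`|x|]. So [`|S x| <= `|x|] while [dot (S x) x = `|x| ^+ 2], and the square of
    [S x - x] expands to [`|S x| ^+ 2 - `|x| ^+ 2 <= 0]. This bypasses
    polarization, and covers real and complex scalars alike. *)
Lemma parseval_iff V c : (forall i, closed_subspace (V i)) -> weights c ->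
    (forall x, has_sum (fun i => c i ^+ 2 *: orthoproj dot (V i) x)) ->
  parseval_fusion_frame dot V c <->
  forall x, sum (fun i => c i ^+ 2 *: orthoproj dot (V i) x) = x.
Proof.
move=> cV c_gt0 hs.
have c0 i : 0 <= c i := ltW (c_gt0 i).
have dotsum x z : has_sum (fun i => dot (c i ^+ 2 *: orthoproj dot (V i) x) z : K^o) /\
   sum (fun i => dot (c i ^+ 2 *: orthoproj dot (V i) x) z : K^o)
   = dot (sum (fun i => c i ^+ 2 *: orthoproj dot (V i) x)) z.
  apply: (@has_sum_map K I H K^o (fun x => dot x z)) (hs x).
  - by rewrite linear0l.
  - by move=> a b; rewrite linearDl.
  - exact: continuous_dotl.
have uE x : (fun i => c i ^+ 2 * `|orthoproj dot (V i) x| ^+ 2 : K^o)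
    = (fun i => dot (c i ^+ 2 *: orthoproj dot (V i) x) x : K^o).
  apply/funext => i; rewrite dotZl [dot _ x]dot_sym dot_orthoproj_self //.
  by rewrite theta_nneg ?exprn_ge0.
split=> [[_ _ pars] x|fix_ ]; last first.
  split=> // x /=; rewrite uE; have [? ->] := dotsum x x; split=> //.
  by rewrite fix_ dotxx mul1r lexx.
have [su /le_anti] := pars x; rewrite !mul1r => sE.
have bV z (A : {fset I}) :
    \sum_(i <- A) c i ^+ 2 * `|orthoproj dot (V i) z| ^+ 2 <= 1 * `|z| ^+ 2.
  have [sz /andP[_]] := pars z; apply: le_trans; apply: partial_sum_le_sum => // i.
  by rewrite mulr_ge0 ?exprn_ge0.
pose g i := c i *: orthoproj dot (V i) x.
have gE : (fun i => `|g i| ^+ 2 : K^o)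
    = (fun i => c i ^+ 2 * `|orthoproj dot (V i) x| ^+ 2).
  by apply/funext => i; rewrite normrZ exprMn ger0_norm.
have Vg : @dom K (dsum dot V) g.
  split=> [i|]; last by rewrite gE.
  have [_ V0 lin] := cV i; rewrite /g -[_ *: _]addr0; apply: lin => //.
  exact: orthoproj_mem.
have [_ le1] := synthesis_bound ltr01 cV c0 bV Vg.
have synE : synthesis c g = sum (fun i => c i ^+ 2 *: orthoproj dot (V i) x).
  by congr sum; apply/funext => i; rewrite /g scalerA expr2.
move: le1; rewrite synE gE mul1r -sE => le1.
have dE : dot (sum (fun i => c i ^+ 2 *: orthoproj dot (V i) x)) x = `|x| ^+ 2.
  by have [_ <-] := dotsum x x; rewrite -uE -sE.
apply/eqP; rewrite -subr_eq0 -normr_eq0 -sqrf_eq0; apply/eqP/le_anti.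
rewrite exprn_ge0 // andbT normsqB dE theta_nneg ?exprn_ge0 // subrK.
by rewrite subr_le0.
Qed.

Lemma fusion_frame_bessel V c : fusion_frame dot V c ->
  exists2 B, 0 < B & forall x (A : {fset I}),
    \sum_(i <- A) c i ^+ 2 * `|orthoproj dot (V i) x| ^+ 2 <= B * `|x| ^+ 2.
Proof.
move=> [b [B [b0 bB [_ c_gt0 bnd]]]]; exists B; first exact: lt_le_trans bB.
move=> x A; have [sx /andP[_]] := bnd x; apply: le_trans.
apply: partial_sum_le_sum => // i.
by rewrite mulr_ge0 ?exprn_ge0 // ltW.
Qed.

Section Bessel.
Context {V : I -> set H} {c : I -> K} {B : K}.
Hypothesis B0 : 0 < B.
Hypothesis cV : forall i, closed_subspace (V i).
Hypothesis c_gt0 : weights c.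
Hypothesis bV : forall x (A : {fset I}),
  \sum_(i <- A) c i ^+ 2 * `|orthoproj dot (V i) x| ^+ 2 <= B * `|x| ^+ 2.

Let c0 i : 0 <= c i. Proof. exact: ltW. Qed.

Lemma analysis_dsum x :
  @dom K (dsum dot V) (fun i => c i *: orthoproj dot (V i) x).
Proof.
split=> [i|]; first by apply: closed_subspaceZ => //; exact: orthoproj_mem.
apply: (proj1 (@bounded_has_sum K I hilbert_RC _ (B * `|x| ^+ 2) _ _)).
  by move=> i; rewrite exprn_ge0.
move=> A; apply: le_trans (bV x A); rewrite le_eqVlt; apply/orP; left; apply/eqP.
by apply: eq_bigr => i _; rewrite normrZ exprMn ger0_norm.
Qed.

Lemma adjoint_synthesis y :
  adjoint (dsum dot V) (whole dot) (synthesis c) y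
  = (fun i => c i *: orthoproj dot (V i) y).
Proof.
apply: adjoint_dsumP => //; first exact: analysis_dsum.
move=> h [Vh sh].
have [sc _] := synthesis_bound B0 cV c0 bV (conj Vh sh).
have [_ sE] := @has_sum_map K I H K^o (fun x => dot x y) (fun i => c i *: h i)
  (linear0l _ _) (fun a b => linearDl _ _ _ _) (continuous_dotl (y := y)) sc.
apply: etrans (esym sE) _; congr sum; apply/funext => i /=.
by rewrite dotZl dotZr theta_nneg // dot_orthoproj.
Qed.

End Bessel.

(** * The scaling operator and the frame operator of the scaled family *)

(** The bound of the inverse of the scaling operator, on families with a single
    nonzero entry: [gamma i] times the norm of [x] is controlled by that of [U x],
    uniformly in [i]. *)
Lemma scaling_op_bounded_below V (gamma : I -> K) (U : {linear H -> H}) :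
    (forall i, closed_subspace (V i)) ->
    (forall i, closed_subspace (U @` V i)) ->
    invertible_op (dsum dot V) (dsum dot (fun i => U @` V i)) (scaling_op U gamma) ->
  exists2 M, 0 < M &
    forall i x, V i x -> `|x| ^+ 2 <= M * `|(gamma i)^-1 *: U x| ^+ 2.
Proof.
move=> cW cUW [_ [D_fun D_inj _] [_ [M Dinv_bound]]].
exists (`|M| + 1); first by rewrite ltr_wpDl.
move=> i x Wx; apply: le_mul_norm_add1; rewrite ?exprn_ge0 //.
have Wsx := single_dsum cW Wx.
have := Dinv_bound _ (D_fun _ Wsx); rewrite op_invK //.
have -> : scaling_op U gamma (single i x) = single i ((gamma i)^-1 *: U x).
  apply/funext => j; rewrite /scaling_op /single.
  by case: eqP => [->//|_]; rewrite linear0 scaler0.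
by rewrite !form_single /single eqxx !dotxx.
Qed.

Section Scaling.
Context {W : I -> set H} {w gamma : I -> K} {B : K}.
Context {U : {linear H -> H}} {Uinv : H -> H} {C M : K}.
Hypothesis B0 : 0 < B.
Hypothesis cW : forall i, closed_subspace (W i).
Hypothesis w_gt0 : weights w.
Hypothesis gamma_gt0 : weights gamma.
Hypothesis bW : forall x (A : {fset I}),
  \sum_(i <- A) w i ^+ 2 * `|orthoproj dot (W i) x| ^+ 2 <= B * `|x| ^+ 2.
Hypothesis C0 : 0 < C.
Hypothesis U_bound : forall x, `|U x| ^+ 2 <= C * `|x| ^+ 2.
Hypothesis UK : cancel U Uinv.
Hypothesis UinvK : cancel Uinv U.
Hypothesis cUW : forall i, closed_subspace (U @` W i).
Hypothesis M0 : 0 < M.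
Hypothesis D_below : forall i x, W i x ->
  `|x| ^+ 2 <= M * `|(gamma i)^-1 *: U x| ^+ 2.

Let c i := w i * gamma i.
Let c_gt0 : weights c. Proof. by move=> i; exact: mulr_gt0. Qed.
Let c0 i : 0 <= c i. Proof. exact: ltW. Qed.

(** Write [g] for the analysis coefficients of [z] in the scaled family and [s]
    for their squared norm over [A]. The vector [v] synthesized from [g] is [U] of
    the vector synthesized, with weights [w], from the [gamma i *: Uinv (g i)];
    this uses the bound of [U], the upper frame bound of [W] and [D_below] to give
    [`|v| ^+ 2 <= L * s]. Also [dot v z = s], and expanding the nonnegative square
    of [v - L *: z] yields [s <= L * `|z| ^+ 2]. *)
Lemma scaled_bessel z (A : {fset I}) :
  \sum_(i <- A) c i ^+ 2 * `|orthoproj dot (U @` W i) z| ^+ 2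
  <= C * B * M * `|z| ^+ 2.
Proof.
set L := C * B * M; have L0 : 0 < L by rewrite !mulr_gt0.
pose g i := c i *: orthoproj dot (U @` W i) z.
set s := \sum_(i <- A) _; pose v := \sum_(i <- A) c i *: g i.
have gE i : `|g i| ^+ 2 = c i ^+ 2 * `|orthoproj dot (U @` W i) z| ^+ 2.
  by rewrite normrZ exprMn ger0_norm.
have s0 : 0 <= s by apply: sumr_ge0 => i _; rewrite mulr_ge0 ?exprn_ge0.
have vz : dot v z = s.
  rewrite linear_sumlz; apply: eq_bigr => i _.
  rewrite [LHS]dotZl dotZl [dot _ z]dot_sym dot_orthoproj_self //.
  by rewrite theta_nneg ?exprn_ge0 // mulrA expr2.
pose f i := gamma i *: Uinv (g i).
have Uf i : U (f i) = gamma i *: g i by rewrite linearZ /= UinvK.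
have Wf i : W i (f i).
  have [x Wx xE] : (U @` W i) (g i).
    by apply: closed_subspaceZ => //; exact: orthoproj_mem.
  by apply: closed_subspaceZ => //; rewrite -xE UK.
have vE : v = U (\sum_(i <- A) w i *: f i).
  rewrite linear_sum; apply: eq_bigr => i _.
  have -> : U (w i *: f i) = w i *: U (f i) by exact: linearZ.
  by rewrite Uf scalerA.
have vL : `|v| ^+ 2 <= L * s.
  rewrite vE; apply: le_trans (U_bound _) _.
  rewrite /L -!mulrA ler_pM2l //.
  have w0 i : 0 <= w i := ltW (w_gt0 i).
  apply: (le_trans (synthesis_fset_bound B0 cW w0 (fun x => bW x A) Wf)).
  rewrite ler_pM2l // mulr_sumr ler_sum // => i _.
  apply: le_trans (D_below (Wf i)) _.
  by rewrite Uf scalerA mulVf ?scale1r ?gE // gt_eqF.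
have := exprn_ge0 2 (normr_ge0 (v - L *: z)).
rewrite normsqB dotZr theta_nneg ?(ltW L0) // vz.
rewrite (theta_nneg (mulr_ge0 (ltW L0) s0)) normrZ exprMn (gtr0_norm L0) => h.
have : 0 <= L * s - L * s - L * s + L ^+ 2 * `|z| ^+ 2.
  by apply: le_trans h _; rewrite !lerD2r.
by rewrite subrr sub0r addrC subr_ge0 expr2 -mulrA ler_pM2l.
Qed.

(** The adjoint of the scaling operator acts entrywise, as the adjoint of [U]
    followed by projection and division by [gamma i]. This is an equality of the
    terms of the two sums; convergence matters only to make [a] square summable,
    and there the bound on [(gamma i)^-1] enters. *)
Lemma adjoint_scaling g :
    @dom K (dsum dot (fun i => U @` W i)) g ->
  let a := fun i => (gamma i)^-1 *:
     orthoproj dot (W i) (adjoint (whole dot) (whole dot) U (g i)) in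
  [/\ (exists N, forall i, (gamma i)^-1 <= N) ->  @dom K (dsum dot W) a
    & forall h, @dom K (dsum dot W) h ->
     @Defs.form K (dsum dot (fun i => U @` W i)) (scaling_op U gamma h) g
     = @Defs.form K (dsum dot W) h a].
Proof.
move=> [Vg sg] a; split=> [[N gammaN]|h [Wh _]]; last first.
  congr sum; apply/funext => i.
  rewrite dotZl dotZr theta_nneg ?invr_ge0 ?(ltW (gamma_gt0 i)) //.
  by rewrite dot_orthoproj // (adjoint_wholeP _ _ C0 U_bound).
split=> [i|]; first by apply: closed_subspaceZ => //; exact: orthoproj_mem.
apply: (@le_has_sum K I hilbert_RC _ _ (`|N| ^+ 2 * C)) sg; last first.
- by move=> i; rewrite exprn_ge0.
- move=> i; rewrite exprn_ge0 //= normrZ exprMn -[leRHS]mulrA.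
  have gV0 : 0 <= (gamma i)^-1 by rewrite invr_ge0 ltW.
  apply: ler_pM; rewrite ?exprn_ge0 //.
    have gN : (gamma i)^-1 <= `|N|.
      by rewrite [leRHS]ger0_norm ?gammaN // (le_trans gV0).
    by rewrite (ger0_norm gV0); rewrite ler_pXn2r ?nnegrE.
  apply: le_trans (norm_orthoproj_le _ _) _ => //.
  apply: (adjoint_bound U_bound) => x; exact: (adjoint_wholeP _ _ C0 U_bound).
by rewrite mulr_ge0 ?exprn_ge0 // ltW.
Qed.

Hypothesis gammaV_bounded : exists N, forall i, (gamma i)^-1 <= N.
Local Notation SW := (dsum dot W).
Local Notation SUW := (dsum dot (fun i => U @` W i)).
Local Notation Hs := (whole dot).
Local Notation D := (scaling_op U gamma).
Hypothesis D_bij : set_bij (@dom K SW) (@dom K SUW) D.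

(** The range of the scaling operator is the whole direct sum, so that elements
    with the same adjoint image have the same pairing with every vector. *)
Lemma adjoint_scaling_inj :
  {in @dom K SUW &, injective (adjoint SW SUW D)}.
Proof.
move=> g g'; rewrite !inE => Vg Vg' eq_adj; apply: (dsum_separated cUW Vg Vg').
move=> h Vh; have [Wh <-] := op_inv_mem D_bij Vh.
have [Wa aE] := adjoint_scaling Vg; have [Wa' aE'] := adjoint_scaling Vg'.
rewrite aE // aE' //; congr Defs.form.
rewrite -(adjoint_dsumP cW (Wa gammaV_bounded) aE) eq_adj.
exact: (adjoint_dsumP cW (Wa' gammaV_bounded) aE').
Qed.

(** The vector [z] is the value at [y] of the inverse of the adjoint of [U]. The
    inverse of the adjoint of [D] sends the analysis of [y] by [W] to the analysis
    [g] of [z] by the scaled family: for [x] in [W i], projecting [z] onto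
    [U @` W i] does not change its inner product with [U x], which is [dot x y].
    After that, [U] turns synthesis of the inverse image of [g] under [D] into
    synthesis of [g] with weights [c]. *)
Lemma scaled_frame_operatorE y z : (forall x, dot (U x) z = dot x y) ->
  let u := fun i => c i ^+ 2 *: orthoproj dot (U @` W i) z in
  has_sum u /\
  U ((synthesis w \o op_inv SW SUW D \o op_inv SUW SW (adjoint SW SUW D)
      \o adjoint SW Hs (synthesis w)) y) = sum u.
Proof.
move=> Uz u; pose g i := c i *: orthoproj dot (U @` W i) z.
have Vg : @dom K SUW g := analysis_dsum cUW c_gt0 scaled_bessel z.
have adjT := adjoint_synthesis B0 cW w_gt0 bW y.
have adjD : adjoint SW SUW D g = adjoint SW Hs (synthesis w) y.
  rewrite adjT; apply: adjoint_dsumP => //.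
    exact: (analysis_dsum cW w_gt0 bW y).
  move=> h [Wh _]; congr sum; apply/funext => i.
  have gV0 : 0 <= (gamma i)^-1 by rewrite invr_ge0 ltW.
  rewrite dotZl !dotZr !theta_nneg ?(ltW (w_gt0 i)) //.
  rewrite dot_orthoproj //; last by exists (h i).
  rewrite dot_orthoproj // Uz /c mulrA mulrCA mulVf ?mulr1 //.
  by rewrite gt_eqF.
rewrite [X in U X]/= -adjD op_invK //; last exact: adjoint_scaling_inj.
have [Wf Df] := op_inv_mem D_bij Vg.
set f := op_inv SW SUW D g in Wf Df *.
have [sf _] := synthesis_bound B0 cW (fun i => ltW (w_gt0 i)) bW Wf.
have [] := @has_sum_map K I H H U (fun i => w i *: f i) (linear0 U) (linearD U)
  (bounded_additive_continuous C0 (linearB U) U_bound) sf.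
have -> // : U \o (fun i => w i *: f i) = u.
apply/funext => i; rewrite /=.
have -> : U (w i *: f i) = w i *: U (f i) by exact: linearZ.
have <- : gamma i *: g i = U (f i).
  by rewrite -Df /scaling_op scalerA divff ?scale1r // gt_eqF.
by rewrite /u /g !scalerA.
Qed.

End Scaling.
End Families.
End HilbertSpace.

(** * Scalability *)

Theorem theorem2p4 (K : numFieldType) (H : completeNormedModType K)
    (theta : {rmorphism K -> K}) (dot : {dot H for theta})
    (I : countType) (W : I -> set H) (w : I -> K)
    (U : {linear H -> H}) (gamma : I -> K)
    (hilbH : hilbert dot) (sepH : separable_space H)
    (frameW : fusion_frame dot W w)
    (invU : invertible_op (whole dot) (whole dot) U)
    (gamma_gt0 : weights gamma)
    (gammaV_bounded : exists M : K, forall i, (gamma i)^-1 <= M) :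
  let Hs := whole dot in
  let SW := dsum dot W in
  let SUW := dsum dot (fun i => U @` W i) in
  let T : carrier SW -> carrier Hs := synthesis w in
  let D : carrier SW -> carrier SUW := scaling_op U gamma in
  invertible_op SW SUW D ->
  (scalable_fusion_frame dot U gamma W w <->
   T \o op_inv SW SUW D \o op_inv SUW SW (adjoint SW SUW D) \o adjoint SW Hs T
   = op_inv Hs Hs (adjoint Hs Hs U \o U)).
Proof.
move=> Hs SW SUW T D invD.
have [U_bdd U_bij Uinv_bdd] := invU.
have [C C0 U_bound] := bounded_op_wholeP hilbH U_bdd.
have [C' C'0 Uinv_bound] := bounded_op_wholeP hilbH Uinv_bdd.
pose Uinv : H -> H := op_inv Hs Hs U.
have UK : cancel U Uinv.
  by move=> x; rewrite /Uinv op_invK //; case: U_bij.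
have UinvK : cancel Uinv U.
  by move=> x; have [] := op_inv_mem U_bij (Logic.I : @dom K Hs x).
have Uinv_lin a : {morph Uinv : x y / a *: x + y}.
  by move=> x y; rewrite -[x in LHS]UinvK -[y in LHS]UinvK -linearP UK.
have UinvB : {morph Uinv : x y / x - y}.
  by move=> x y; rewrite -[x in LHS]UinvK -[y in LHS]UinvK -linearB UK.
have UinvC := bounded_additive_continuous C'0 UinvB Uinv_bound.
have [cW w_gt0] : (forall i, closed_subspace (W i)) /\ weights w.
  by case: frameW => ? [? [_ _ []]].
have cUW i := closed_subspace_image UK UinvK UinvC (cW i).
have [B B0 bW] := fusion_frame_bessel frameW.
have [M M0 D_below] := scaling_op_bounded_below hilbH cW cUW invD.
have [_ D_bij _] := invD.
have frame_op := scaled_frame_operatorE hilbH B0 cW w_gt0 gamma_gt0 bW C0 U_bound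
  UK UinvK cUW M0 D_below gammaV_bounded D_bij.
have adjU := fun x y => adjoint_wholeP hilbH x y C0 U_bound.
(* U applied to the inverse of (adjoint of U) times U is the inverse of the
   adjoint of U. *)
have rhsE y z : (forall x, dot (U x) z = dot x y) ->
    U (op_inv Hs Hs (adjoint Hs Hs U \o U) y) = z.
  move=> Uz; have -> : y = (adjoint Hs Hs U \o U) (Uinv z).
    by apply: (dot_inj hilbH) => x; rewrite /= UinvK -adjU Uz.
  rewrite op_invK // => a b _ _ /= eq_ab; rewrite -[a]UK -[b]UK.
  congr Uinv; apply: (dot_inj hilbH) => x.
  by rewrite -[x]UinvK !adjU eq_ab.
have solve y : exists z, forall x, dot (U x) z = dot x y.
  have [z zE] := adjoint_exists hilbH y C'0 Uinv_lin Uinv_bound.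
  by exists z => x; rewrite -zE UK.
have hs z : has_sum (fun i => (w i * gamma i) ^+ 2 *: orthoproj dot (U @` W i) z).
  by have [] := frame_op _ z (fun x => adjU x z).
have wg_gt0 : weights (fun i => w i * gamma i) by move=> i; exact: mulr_gt0.
apply: iff_trans (parseval_iff hilbH cUW wg_gt0 hs) _.
split=> [fix_|eq_op z].
  apply/funext => y; have [z Uz] := solve y; apply: (can_inj UK).
  have [_ ->] := frame_op _ _ Uz; by rewrite fix_ (rhsE _ _ Uz).
have Uz x := adjU x z.
have [_ <-] := frame_op _ _ Uz.
by rewrite [X in U (X _)]eq_op; exact: rhsE.
Qed.
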